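(* Let $k$ be a field of characteristic zero, $m\ge 3$, let $\mathcal{GC}$ be the $m\times m$ matrix over $R=k[x_{i,j}\mid 1\le i,j\le m,\ (i,j)\ne(m,m)]$ whose $(i,j)$-entry is $x_{i,j}$ for $(i,j)\neq (m,m)$ and whose $(m,m)$-entry is $x_{m-1,m-1}$, and let $f=\det(\mathcal{GC})$. Then $\dim V(f)^*=2m-2$. In particular, the expected multiplicity of $f$ as a factor of its Hessian determinant $h(f)$ is $m(m-2)-1$.
   Context: The $x_{i,j}$ with $(i,j)\ne(m,m)$ are $m^2-1$ independent variables over $k$, so $V(f)\subset\mathbb{P}^{m^2-2}$. $V(f)^*$ denotes the dual variety of the hypersurface $V(f)$, i.e. the closure of the image of $V(f)$ under the map given by the partial derivatives of $f$; its homogeneous coordinate ring is the $k$-subalgebra of $R/(f)$ generated by the residue classes of the partial derivatives of $f$ (up to degree normalization). Dimension is as a projective variety. The Hessian determinant $h(f)$ is the determinant of the matrix of second partial derivatives of $f$ with respect to the variables of $R$. The expected multiplicity (according to Segre) of $f$ as a factor of $h(f)$ is the number $m^2-3-\dim V(f)^*=\mathrm{codim}(V(f)^* )-1$, where the codimension is taken in $\mathbb{P}^{m^2-2}$. *)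

(* Defs.v *)
From HB Require Import structures.
From mathcomp Require Import all_boot all_order all_algebra.
From mathcomp Require Export ring_quotient mpoly.

Set Implicit Arguments.
Unset Strict Implicit.
Unset Printing Implicit Defensive.

Import GRing.Theory.
Local Open Scope ring_scope.

Section ProjectiveDimension.

Variables (k : fieldType) (n : nat).
Local Notation S := {mpoly k[n]}.

Definition homogeneous_pred (P : {pred S}) : Prop :=
  forall F d, F \in P -> pihomog mdeg d F \in P.

(* Points of Proj S, where P^(n-1) = Proj S: the last clause excludes the
   primes containing the irrelevant ideal ('X_0, ..., 'X_(n-1)). *)
Definition proj_point (P : {pred S}) : Prop :=
  [/\ idealr_closed P, prime_idealr_closed P, homogeneous_pred P
    & ~ forall i : 'I_n, 'X_i \in P].

(* A chain P_0 < ... < P_d of points of Proj S in the zero locus of J, i.e. a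
   chain of d + 1 irreducible closed subsets of that locus. *)
Definition proj_chain (J : S -> Prop) (d : nat) (P : nat -> {pred S}) : Prop :=
  [/\ forall i, (i <= d)%N -> proj_point (P i),
      forall i, (i <= d)%N -> forall F, J F -> F \in P i
    & forall i, (i < d)%N ->
        {subset P i <= P i.+1} /\ ~ {subset P i.+1 <= P i}].

(* The closed subset of P^(n-1) defined by J has (Krull) dimension d. *)
Definition proj_dim (J : S -> Prop) (d : nat) : Prop :=
  (exists P, proj_chain J d P) /\
  (forall e P, proj_chain J e P -> (e <= d)%N).

End ProjectiveDimension.

Section DualVariety.

Variables (k : fieldType) (n : nat).

Definition gradient (f : {mpoly k[n]}) : n.-tuple {mpoly k[n]} :=
  [tuple f^`M(i) | i < n].

(* The kernel of k[y_0, ..., y_(n-1)] -> k[x]/(f), y_i |-> df/dx_i; the quotient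
   by it is the k-subalgebra of k[x]/(f) generated by the classes of the partial
   derivatives. For reduced f this is the homogeneous ideal of V(f)^*. *)
Definition dual_ideal (f : {mpoly k[n]}) (F : {mpoly k[n]}) : Prop :=
  exists G : {mpoly k[n]}, F \mPo gradient f = G * f.

Definition dual_dim (f : {mpoly k[n]}) (d : nat) : Prop :=
  proj_dim (dual_ideal f) d.

(* Segre's expected multiplicity of f as a factor of its Hessian determinant:
   codim V(f)^* - 1 in P^(n-1). It is determined by V(f)^* alone and makes
   no reference to the factorization of the Hessian determinant. *)
Definition expected_hessian_mult (f : {mpoly k[n]}) (e : int) : Prop :=
  exists2 d : nat, dual_dim f d & e = (n%:Z - 1) - d%:Z - 1.

End DualVariety.

Section DegenerateMatrix.

Variables (k : fieldType) (m : nat).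

(* With 0-based indices, x_(i,j) is the variable number i * m + j; this numbers
   the pairs (i,j) <> (m-1,m-1) bijectively by 0, ..., m^2 - 2. The default 0
   is reached only for (m-1,m-1), to which no variable is attached. *)
Definition xvar (i j : nat) : {mpoly k[(m ^ 2).-1]} :=
  if insub (i * m + j)%N is Some t then 'X_t else 0.

Definition GC : 'M[{mpoly k[(m ^ 2).-1]}]_m :=
  \matrix_(i < m, j < m)
    if (i == m.-1 :> nat) && (j == m.-1 :> nat) then xvar m.-2 m.-2
    else xvar i j.

End DegenerateMatrix.

(* Main.v *)
(* The gradient of f is the cofactor matrix C of GC, with the entries (m,m) and
   (m-1,m-1) added up. Since the 2x2 minors of C are multiples of f, the dual
   variety is the image of the Segre variety of rank one matrices u v^T under
   the linear projection y_(m-1,m-1) + y_(m,m), which is finite.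

   Upper bound: along a chain of e + 1 homogeneous primes the Hilbert function
   of the first one grows at least like d^e on multiples of some degree, because
   multiplication by an element of the next prime is injective modulo the
   previous one. On the other hand, the forms of degree d modulo the vanishing
   ideal of u v^T embed into the space of polynomials of bidegree (d, d) in
   (u, v), whose dimension is at most (d+1)^(2m-2).

   Lower bound: the matrices c a b^T with a_1 = b_1 = 1 are cofactor matrices of
   singular matrices X with X_(m-1,m-1) = X_(m,m), so the dual ideal vanishes on
   them; setting the 2m - 2 other coordinates of a and b to 0 one by one gives a
   chain of primes. *)

From HB Require Import structures.
Require Import Defs.
From mathcomp Require Import all_boot all_order all_algebra.
From mathcomp Require Import perm zify.
From Stdlib Require Import Classical.
Import GRing.Theory.
Local Open Scope ring_scope.

Set Implicit Arguments.
Unset Strict Implicit.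
Unset Printing Implicit Defensive.

(** * Exchange identities between cofactors *)

Section Cofactors.

Variables (R : comNzRingType) (n : nat).
Implicit Types (A : 'M[R]_n) (i j k : 'I_n).

Definition set_row A i (w : 'rV[R]_n) : 'M[R]_n :=
  \matrix_(r, s) if r == i then w 0 s else A r s.

Lemma det_set_row A i w : \det (set_row A i w) = \sum_j w 0 j * cofactor A i j.
Proof.
rewrite (expand_det_row _ i); apply: eq_bigr => j _; rewrite mxE eqxx.
congr (_ * (_ * \det _)); apply/matrixP=> r s.
by rewrite !mxE eq_sym (negbTE (neq_lift _ _)).
Qed.

Lemma det_set_row_delta A i j : \det (set_row A i (delta_mx 0 j)) = cofactor A i j.
Proof.
rewrite det_set_row (bigD1 j) //= mxE !eqxx mul1r big1 ?addr0 // => l ne_lj.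
by rewrite mxE (negbTE ne_lj) andbF mul0r.
Qed.

Lemma det_xrow A i k : i != k -> \det (xrow i k A) = - \det A.
Proof. by move=> ne; rewrite xrowE det_mulmx det_perm odd_tperm ne mulN1r. Qed.

(* Cramer's rule for the matrix A' obtained from A by replacing its row i by a
   unit vector, applied to w with its i-th entry replaced by 0. *)
Lemma cofactor_exchange A (w : 'rV[R]_n) i k j : i != k ->
  w 0 k * cofactor A i j - w 0 i * cofactor A k j =
  \sum_l (w *m A) 0 l * cofactor (set_row A i (delta_mx 0 j)) k l.
Proof.
move=> ne_ik; set A' := set_row _ _ _.
pose w' := w - w 0 i *: delta_mx 0 i.
have w'A : w' *m A' = w *m A - w 0 i *: row i A.
  apply/rowP => s; rewrite !mxE (bigD1 i) //= [X in _ = X - _](bigD1 i) //= !mxE.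
  rewrite !eqxx mulr1 subrr mul0r add0r addrAC subrr add0r.
  apply: eq_bigr => r ne_ri; rewrite !mxE (negbTE ne_ri) andbF mulr0 subr0 //.
have := congr1 (fun v : 'rV_n => (v *m \adj A') 0 k) w'A.
rewrite -mulmxA mul_mx_adj mul_mx_scalar det_set_row_delta.
have -> : (cofactor A i j *: w') 0 k = w 0 k * cofactor A i j.
  by rewrite !mxE eqxx /= [k == i]eq_sym (negbTE ne_ik) mulr0 subr0 mulrC.
have -> : ((w *m A - w 0 i *: row i A) *m \adj A') 0 k =
    \sum_l (w *m A) 0 l * cofactor A' k l - w 0 i * \sum_l row i A 0 l * cofactor A' k l.
  rewrite mulmxBl -scalemxAl !mxE; congr (_ - _ * _);
  by apply: eq_bigr => l _; rewrite [\adj _ _ _]mxE.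
move=> ->; rewrite -det_set_row.
(* Row i is now the unit vector and row k the old row i: this is [A] with row k replaced by the unit
   vector, up to one row swap. *)
have -> : \det (set_row A' k (row i A)) = - cofactor A k j.
  rewrite -det_set_row_delta -(det_xrow _ ne_ik); congr (\det _).
  apply/matrixP => r s; rewrite !mxE.
  case: tpermP => [->|->|/eqP/negbTE ne_ri /eqP/negbTE ne_rk].
  - by rewrite (negbTE ne_ik) !eqxx.
  - by rewrite eqxx (negbTE ne_ik).
  - by rewrite ne_rk ne_ri.
by rewrite mulrN opprK addrK.
Qed.

(** Apply [cofactor_exchange] to row l of the adjugate: its product with [A] is [\det A] times a
    unit vector, so a single term of the sum survives. *)
Lemma cofactor_minor A i j k l : exists q,
  cofactor A i j * cofactor A k l - cofactor A k j * cofactor A i l = q * \det A.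
Proof.
have [->|ne_ik] := eqVneq i k; last first.
  pose w : 'rV_n := row l (\adj A).
  exists (cofactor (set_row A i (delta_mx 0 j)) k l).
  have wE r : cofactor A r l = w 0 r by rewrite !mxE.
  rewrite !wE mulrC [X in _ - X]mulrC cofactor_exchange // -row_mul mul_adj_mx.
  rewrite (bigD1 l) //= !mxE eqxx mulrC big1 ?addr0 // => s ne_sl.
  by rewrite !mxE eq_sym (negbTE ne_sl) mul0r.
by exists 0; rewrite mul0r [X in _ - X]mulrC mulrC subrr.
Qed.

(** The right-hand side of [cofactor_exchange] vanishes. No division occurs, so the proportionality
    of cofactor columns to [w] holds over any commutative ring. *)
Lemma cofactor_left_kernel A (w : 'rV[R]_n) i j k : w *m A = 0 ->
  w 0 k * cofactor A i j = w 0 i * cofactor A k j.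
Proof.
move=> wA0; have [->//|ne_ik] := eqVneq i k; apply/eqP.
rewrite -subr_eq0 cofactor_exchange // wA0 big1 // => l _.
by rewrite mxE mul0r.
Qed.

Lemma cofactor_right_kernel A (w : 'cV[R]_n) i j k : A *m w = 0 ->
  w k 0 * cofactor A i j = w j 0 * cofactor A i k.
Proof.
move=> Aw0; have wA0 : w^T *m A^T = 0 by rewrite -trmx_mul Aw0 trmx0.
by have := cofactor_left_kernel j i k wA0; rewrite !mxE !cofactor_tr.
Qed.

End Cofactors.

(** * Derivatives of determinants *)

Section GradientOfDeterminant.

Variables (k : fieldType) (n m : nat).
Implicit Types (A : 'M[{mpoly k[n]}]_m).

Lemma mderiv_prod (I : finType) (t : 'I_n) (F : I -> {mpoly k[n]}) :
  (\prod_i F i)^`M(t) = \sum_i (F i)^`M(t) * \prod_(r | r != i) F r.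
Proof.
suff gen (s : seq I) : uniq s -> (\prod_(i <- s) F i)^`M(t) =
    \sum_(i <- s) (F i)^`M(t) * \prod_(r <- s | r != i) F r.
  by rewrite gen // /index_enum -enumT enum_uniq.
elim: s => [_|i s IH /= /andP[is_ us]]; first by rewrite !big_nil mderivC.
rewrite !big_cons mderivM IH // eqxx /=; congr (_ * _ + _).
  rewrite big_seq [RHS]big_seq_cond; apply: eq_bigl => r.
  by case rs: (r \in s) => //=; apply/esym/eqP => E; rewrite -E rs in is_.
rewrite mulr_sumr big_seq [RHS]big_seq; apply: eq_bigr => r rs.
rewrite big_cons; case: eqVneq => [E|_]; first by rewrite E rs in is_.
by rewrite mulrCA.
Qed.

(** Jacobi's formula: the product rule differentiates one row at a time, and each resulting
    determinant is expanded along its differentiated row. *)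
Lemma mderiv_det A (t : 'I_n) :
  (\det A)^`M(t) = \sum_i \sum_j (A i j)^`M(t) * cofactor A i j.
Proof.
transitivity (\sum_i \det (set_row A i (\row_j (A i j)^`M(t)))); last first.
  apply: eq_bigr => i _; rewrite det_set_row; apply: eq_bigr => j _.
  by rewrite mxE.
rewrite /determinant exchange_big /= raddf_sum /=; apply: eq_bigr => s _.
rewrite -mulr_sumr -signr_odd !mulr_sign.
suff <- : (\prod_i A i (s i))^`M(t) =
    \sum_i \prod_r set_row A i (\row_j (A i j)^`M(t)) r (s r).
  by case: (odd _); rewrite ?raddfN.
rewrite mderiv_prod; apply: eq_bigr => i _.
rewrite [RHS](bigD1 i) //= !mxE eqxx; congr (_ * _).
by apply: eq_bigr => r /negbTE ne; rewrite mxE ne.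
Qed.

End GradientOfDeterminant.

(** * Polynomial substitution, congruences and gradings *)

Section Substitution.

Variables (k : fieldType) (n l : nat).
Implicit Types (F : {mpoly k[n]}) (g h : n.-tuple {mpoly k[l]}).

Lemma comp_mpoly_assoc p F g (h : l.-tuple {mpoly k[p]}) :
  (F \mPo g) \mPo h = F \mPo [tuple tnth g i \mPo h | i < n].
Proof.
rewrite [F \mPo g]comp_mpolyE [RHS]comp_mpolyE raddf_sum /=.
apply: eq_bigr => m _; rewrite comp_mpolyZ rmorph_prod /=; congr (_ *: _).
by apply: eq_bigr => i _; rewrite rmorphXn /= tnth_mktuple.
Qed.

Lemma comp_mpoly_scale d F (c : {mpoly k[l]}) g : F \is d.-homog ->
  F \mPo [tuple c * tnth g i | i < n] = c ^+ d * (F \mPo g).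
Proof.
move=> /dhomogP homF; rewrite !comp_mpolyE mulr_sumr !big_seq.
apply: eq_bigr => m /homF dm; rewrite -scalerAr -(dm : mdeg m = d) mdegE.
rewrite -prodrXr -big_split /=.
by congr (_ *: _); apply: eq_bigr => i _; rewrite tnth_mktuple exprMn.
Qed.

(** Congruence modulo [f] respects sums and products, hence substitution into a polynomial. *)
Lemma comp_mpoly_congr F g h (f : {mpoly k[l]}) :
  (forall i, exists q, tnth g i - tnth h i = q * f) ->
  exists q, (F \mPo g) - (F \mPo h) = q * f.
Proof.
move=> gh; pose C (a b : {mpoly k[l]}) := exists q, a - b = q * f.
have CM a b a' b' : C a b -> C a' b' -> C (a * a') (b * b').
  move=> [q Eq] [q' Eq']; exists (q * a' + q' * b).
  rewrite mulrDl -mulrA [a' * f]mulrC mulrA -Eq -mulrA [b * f]mulrC mulrA -Eq'.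
  by rewrite !mulrBl [b * a']mulrC addrA subrK [b' * b]mulrC.
have C0 a : C a a by exists 0; rewrite mul0r subrr.
suff: C (F \mPo g) (F \mPo h) by [].
rewrite !comp_mpolyE; apply: (big_ind2 C) => //.
  move=> a b a' b' [q Eq] [q' Eq']; exists (q + q').
  by rewrite mulrDl -Eq -Eq' opprD addrACA.
move=> m _; rewrite -!mul_mpolyC; apply: (CM) => //.
apply: (big_ind2 C) => // i _.
elim: (m i) => [|e IH]; first by rewrite !expr0.
by rewrite !exprS; apply: (CM).
Qed.

Section Graded.

Variables (mf : measure l) (g : n.-tuple {mpoly k[l]}).
Hypothesis g_homog : forall i, tnth g i \is 1.-homog for mf.

(** The target grading [mf] is arbitrary: it will be the degree in one block of variables for the
    Segre map, and the degree in a single variable for the cones. *)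
Lemma dhomog_comp_mpoly d F : F \is d.-homog -> F \mPo g \is d.-homog for mf.
Proof.
move=> /dhomogP homF; rewrite comp_mpolyE big_seq; apply: rpred_sum => m /homF dm.
rewrite -(dm : mdeg m = d).
apply: rpredZ; rewrite mdegE; elim/big_rec2: _ => [|i d' p _ hp].
  exact: dhomog1.
by apply: dhomogM => //; have := dhomogMn (m i) (g_homog i); rewrite mul1n.
Qed.

Lemma pihomog_comp_mpoly d F :
  pihomog mf d (F \mPo g) = pihomog mdeg d F \mPo g.
Proof.
have -> : F \mPo g = \sum_(m <- msupp F) ((F@_m *: 'X_[m]) \mPo g).
  by rewrite -raddf_sum -mpolyE.
rewrite [pihomog _ _ F]pihomogE !raddf_sum [RHS]big_mkcond /=.
apply: eq_bigr => m _; have mhom : ('X_[m] : {mpoly k[n]}) \is (mdeg m).-homog.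
  by rewrite dhomogX.
have := dhomog_comp_mpoly (rpredZ F@_m mhom).
case: eqP => [<- /pihomog_dE -> //|/eqP ne]; exact: pihomog_ne0.
Qed.

(** The kernel of a graded map into a domain is a homogeneous prime; a nonzero [tnth g i] keeps it
    from containing the irrelevant ideal. *)
Lemma proj_point_ker : (exists i, tnth g i != 0) ->
  proj_point [pred F | F \mPo g == 0].
Proof.
move=> [i0 gi0]; split.
- split; rewrite ?inE ?comp_mpoly0 // ?comp_mpoly1 ?oner_eq0 //.
  move=> a u v; rewrite !inE => /eqP u0 /eqP v0.
  by rewrite comp_mpolyD rmorphM /= u0 v0 mulr0 addr0.
- by move=> u v; rewrite !inE rmorphM mulf_eq0.
- by move=> F d; rewrite !inE -pihomog_comp_mpoly => /eqP->; rewrite pihomog0.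
move/(_ i0); rewrite inE comp_mpolyXU -tnth_nth => /eqP E.
by rewrite E eqxx in gi0.
Qed.

End Graded.

End Substitution.

(** * Growth of Hilbert functions along chains of homogeneous primes *)

Section HilbertFunction.

Variables (k : fieldType) (n : nat).
Local Notation S := {mpoly k[n]}.
Implicit Types (P Q : {pred S}) (d N : nat).

Section IdealClosure.

Variable P : {pred S}.
Hypothesis PP : proj_point P.

Lemma proj_point0 : 0 \in P. Proof. by case: PP => [[]]. Qed.

Lemma proj_pointD : {in P &, forall F G, F + G \in P}.
Proof. by move=> F G PF PG; case: PP => [[_ _ /(_ 1 F G PF PG)]]; rewrite mul1r. Qed.

Lemma proj_pointMl F G : G \in P -> F * G \in P.
Proof.
by move=> PG; case: PP => [[P0 _ /(_ F G 0 PG P0)]]; rewrite addr0.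
Qed.

Lemma proj_pointZ (a : k) F : F \in P -> a *: F \in P.
Proof. by rewrite -mul_mpolyC; apply: proj_pointMl. Qed.

Lemma proj_point_sum I (r : seq I) (p : pred I) (F : I -> S) :
  (forall i, p i -> F i \in P) -> \sum_(i <- r | p i) F i \in P.
Proof.
by move=> PF; apply: (big_ind (fun x => x \in P)) => //;
  [apply: proj_point0 | apply: proj_pointD].
Qed.

Lemma proj_point_const (a : k) : a%:MP \in P -> a = 0.
Proof.
move=> Pa; apply/eqP/negPn/negP => a0; case: PP => [[_ P1 _] _ _ _].
by case/negP: P1; rewrite -[1%R]mpolyC1 -(mulVf a0) mpolyCM; apply: proj_pointMl.
Qed.

Lemma proj_point_prime F G : F * G \in P -> F \notin P -> G \in P.
Proof. by case: PP => _ prP _ _ /prP /orP[->|]. Qed.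

Lemma proj_pointX F e : F ^+ e \in P -> F \in P.
Proof.
elim: e => [|e IH]; last by rewrite exprS => /(let: And4 _ prP _ _ := PP in prP) /orP[].
by rewrite expr0; case: PP => [[_ /negbTE->]].
Qed.

Lemma proj_point_var : exists i : 'I_n, 'X_i \notin P.
Proof.
apply/existsP; rewrite -negb_forall; apply/negP => /forallP allP.
by case: PP => _ _ _; apply.
Qed.

End IdealClosure.

(* The Hilbert function of S/P takes a value at least N in degree d. *)
Definition hilbert_ge P d N := exists2 v : nat -> S,
  (forall i, (i < N)%N -> v i \is d.-homog) &
  (forall c : nat -> k, \sum_(i < N) c i *: v i \in P ->
     forall i, (i < N)%N -> c i = 0).

Lemma hilbert_ge_leq P d N N' : (N' <= N)%N -> hilbert_ge P d N -> hilbert_ge P d N'.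
Proof.
move=> leN [v homv freev]; exists v => [i lt_i|c Pc i lt_i].
  by apply: homv; apply: leq_trans leN.
have := freev (fun i => if (i < N')%N then c i else 0).
move=> /(_ _ i (leq_trans lt_i leN)); rewrite lt_i; apply.
rewrite (big_ord_widen N (fun i => c i *: v i) leN) in Pc.
rewrite big_mkcond in Pc; congr (_ \in P): Pc.
by apply: eq_bigr => j _; case: ifP => //; rewrite scale0r.
Qed.

(* Multiplication by a injects S/P into S/P, with image in the kernel Q/P of
   S/P -> S/Q. *)
Lemma hilbert_ge_step P Q a s d N M : proj_point P -> proj_point Q ->
  {subset P <= Q} -> a \in Q -> a \notin P -> a \is s.-homog ->
  hilbert_ge Q (s + d) N -> hilbert_ge P d M -> hilbert_ge P (s + d) (N + M).
Proof.
move=> PP PQ sPQ Qa Pa homa [v homv freev] [w homw freew].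
exists (fun i => if (i < N)%N then v i else a * w (i - N)%N) => [i lt_i|c].
  case: ltnP => [/homv//|le_N]; apply: dhomogM => //; apply: homw.
  by rewrite ltn_subLR.
rewrite big_split_ord /=.
have -> : \sum_(i < N) c i *: (if (i < N)%N then v i else a * w (i - N)%N) =
          \sum_(i < N) c i *: v i.
  by apply: eq_bigr => i _; rewrite ltn_ord.
have -> : \sum_(i < M) c (N + i)%N *: (if (N + i < N)%N then v (N + i)%N else
            a * w (N + i - N)%N) = a * \sum_(i < M) c (N + i)%N *: w i.
  rewrite mulr_sumr; apply: eq_bigr => i _.
  by rewrite ltnNge leq_addr /= addKn scalerAr.
(* Modulo [Q] the multiples of [a] disappear, which kills the first N coefficients; what remains is
   [a] times a form, and [a] cancels modulo the prime [P]. *)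
move=> Pc; have cN i : (i < N)%N -> c i = 0.
  apply: freev; have Qaw : - 1 * (a * \sum_(i < M) c (N + i)%N *: w i) \in Q.
    by rewrite mulrCA mulrC; apply: proj_pointMl; rewrite ?proj_pointMl.
  have := proj_pointD PQ (sPQ _ Pc) Qaw; rewrite mulN1r addrK //.
rewrite big1 ?add0r in Pc; last by move=> i _; rewrite cN ?scale0r.
move=> i lt_i; case: (ltnP i N) => [/cN//|le_N].
have := freew (fun i => c (N + i)%N) (proj_point_prime PP Pc Pa) (i - N)%N.
by rewrite subnKC // ltn_subLR //; apply.
Qed.

Lemma proj_point_diff P Q : proj_point P -> proj_point Q ->
  ~ {subset Q <= P} -> exists a s,
    [/\ (0 < s)%N, a \is s.-homog, a \in Q & a \notin P].
Proof.
move=> PP PQ nsub.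
have [F nF] := not_all_ex_not _ _ nsub.
have [QF /negP PF] := imply_to_and _ _ nF.
have homQ s : pihomog mdeg s F \in Q by case: PQ => _ _ /(_ F s QF).
have /existsP[s Ps] : [exists s : 'I_(msize F), pihomog mdeg s F \notin P].
  rewrite -negb_forall; apply: contra PF => /forallP PF.
  by rewrite (pihomog_partitionE (leqnn (msize F))) proj_point_sum.
exists (pihomog mdeg s F), s; split=> //; last exact: pihomogP.
(* A component of degree 0 would be a constant in the proper ideal [Q], hence 0, and so would lie in
   [P]. *)
rewrite lt0n; apply: contraNneq Ps => s0.
have /dhomogP h := pihomogP mdeg s F.
have cE : pihomog mdeg s F = ((pihomog mdeg s F)@_0)%:MP.
  apply/mpolyP => m; rewrite mcoeffC; case: eqVneq => [->|m0]; first by rewrite mulr1.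
  rewrite mulr0; apply/eqP; rewrite mcoeff_eq0; apply: contra m0 => /h.
  by rewrite s0 => /eqP; rewrite mdeg_eq0.
have := homQ s; rewrite cE => /(proj_point_const PQ)->.
by rewrite mpolyC0 proj_point0.
Qed.

(** Induction on the chain with its smallest prime removed: d successive multiplications by a form
    of [P 1] outside [P 0] stack d blocks of size [d ^ e]. For [e = 0], powers of a variable outside
    [P 0] suffice. *)
Lemma hilbert_ge_chain e (P : nat -> {pred S}) :
  (forall i, (i <= e)%N -> proj_point (P i)) ->
  (forall i, (i < e)%N -> {subset P i <= P i.+1} /\ ~ {subset P i.+1 <= P i}) ->
  exists2 c, (0 < c)%N & forall d, hilbert_ge (P 0) (c * d) (d ^ e).
Proof.
elim: e P => [|e IH] P PP strict.
  have [i Pi] := proj_point_var (PP 0 isT).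
  exists 1%N => // d; exists (fun=> 'X_i ^+ d) => [_ _|c].
    have := dhomogMn d (_ : ('X_i : S) \is 1.-homog).
    by rewrite mul1n; apply; rewrite dhomogX /= mdeg1.
  rewrite big_ord1 => Pc [|//] _; apply/eqP/negPn/negP => c0; case/negP: Pi.
  apply: (@proj_pointX _ (PP 0 isT) _ d).
  by rewrite -['X_i ^+ d]scale1r -(mulVf c0) -scalerA proj_pointZ //; apply: PP.
have [c c_gt0 Hc] := IH (fun i => P i.+1) (fun i => PP i.+1) (fun i => strict i.+1).
have [sub01 nsub] := strict 0 isT.
have [a [s [s_gt0 homa Qa Pa]]] := proj_point_diff (PP 0 isT) (PP 1 isT) nsub.
(* Multiplying by [a ^+ c] instead of [a] raises the degree by [s * c], so that all degrees stay
   multiples of [c], where the induction hypothesis applies. *)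
have step d j : hilbert_ge (P 0) (s * c * (d + j)) (j * d ^ e).
  elim: j => [|j IHj]; first by exists (fun=> 0) => // i; rewrite mul0n.
  rewrite addnS mulnS mulSn.
  apply: (hilbert_ge_step (Q := P 1%N) _ _ sub01 _ _ (dhomogMn c homa) _ IHj).
  - exact: PP.
  - exact: PP.
  - by rewrite -(prednK c_gt0) exprSr; apply: proj_pointMl => //; apply: PP.
  - by apply: contra Pa; apply: proj_pointX; apply: PP.
  - have := Hc (s * (d + j).+1)%N; rewrite mulnA [(c * s)%N]mulnC mulnS.
    apply: hilbert_ge_leq; case: e {IH PP strict Hc IHj} => // e.
    rewrite leq_exp2r //.
    by rewrite (leq_trans (leq_addr j d)) // (leq_trans (leqnSn _)) // leq_pmull.
exists (s * c * 2)%N => [|d]; first by rewrite !muln_gt0 s_gt0 c_gt0.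
rewrite expnS -mulnA mul2n -addnn; exact: step.
Qed.

(** With more than [#|I|] forms, the matrix of their coefficients at the monomials [mu i] has a
    nonzero left kernel vector, which gives a nontrivial relation modulo [P]. *)
Lemma hilbert_ge_bound l (g : n.-tuple {mpoly k[l]}) (I : finType)
    (mu : I -> 'X_{1..l}) P d N :
  (forall F, F \is d.-homog -> (forall i, (F \mPo g)@_(mu i) = 0) -> F \in P) ->
  hilbert_ge P d N -> (N <= #|I|)%N.
Proof.
move=> inP [v homv freev]; rewrite leqNgt; apply/negP => ltIN.
pose A : 'M[k]_(N, #|I|) := \matrix_(i, j) (v i \mPo g)@_(mu (enum_val j)).
have : kermx A != 0.
  by rewrite kermx_eq0 /row_free neq_ltn (leq_ltn_trans (rank_leq_col A)).
case/rowV0Pn => w /sub_kermxP wA /eqP[]; apply/rowP => i; rewrite mxE.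
pose c j := if insub j is Some j' then w 0 j' else 0.
have cE (j : 'I_N) : c j = w 0 j by rewrite /c valK.
rewrite -cE; apply: freev => //; apply: inP => [|x].
  by apply: rpred_sum => j _; apply: rpredZ; apply: homv.
rewrite (raddf_sum (comp_mpoly g)) (raddf_sum (mcoeff (mu x))) /=.
have := congr1 (fun u : 'rV_#|I| => u 0 (enum_rank x)) wA.
rewrite !mxE => wA0; rewrite -[RHS]wA0; apply: eq_bigr => j _.
by rewrite comp_mpolyZ mcoeffZ mxE enum_rankK cE.
Qed.

End HilbertFunction.

Lemma exponent_leq_of_bound c e r :
  (forall d, d ^ e <= (c * d).+1 ^ r)%N -> (e <= r)%N.
Proof.
move=> bound; rewrite leqNgt; apply/negP => lt_re.
(* As d exceeds (c+1)^r, one gets d^e >= d^(r+1) > ((c+1)d)^r >= (cd+1)^r. *)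
pose d := (c.+1 ^ r).+1; have := bound d; apply/negP; rewrite -ltnNge.
apply: (@leq_ltn_trans ((c.+1 * d) ^ r)).
  case: (r) => // r'; by rewrite leq_exp2r // mulSn -addn1 addnC leq_add2r.
rewrite expnMn; apply: (@leq_trans (d ^ r.+1)); last by rewrite leq_pexp2l.
by rewrite expnS ltn_pmul2r ?expn_gt0.
Qed.

(** * Degree in a subset of the variables *)

Section PartialDegree.

Variable l : nat.

Definition partial_deg (A : pred 'I_l) (s : 'X_{1..l}) : nat :=
  (\sum_(i | A i) s i)%N.

Lemma partial_deg0 A : partial_deg A 0%MM = 0%N.
Proof. by apply: big1 => i _; rewrite mnmE. Qed.

Lemma partial_degD A :
  {morph partial_deg A : s t / (s + t)%MM >-> (s + t)%N}.
Proof. by move=> s t; rewrite -big_split; apply: eq_bigr => i _; rewrite mnmDE. Qed.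

HB.instance Definition _ (A : pred 'I_l) :=
  isMeasure.Build l (partial_deg A) (partial_deg0 A) (partial_degD A).

Lemma partial_degU A i : partial_deg A U_(i)%MM = A i.
Proof.
rewrite /partial_deg; have [Ai|/negbTE Ai] := boolP (A i).
  rewrite (bigD1 i) //= mnm1E eqxx big1 // => j /andP[_ /negbTE ne].
  by rewrite mnm1E eq_sym ne.
apply: big1 => j Aj; rewrite mnm1E; case: eqP => // ij.
by rewrite ij Aj in Ai.
Qed.

Lemma dhomog_var (k : fieldType) (A : pred 'I_l) i :
  ('X_i : {mpoly k[l]}) \is (A i).-homog for (partial_deg A).
Proof. by rewrite dhomogX /= partial_degU. Qed.

End PartialDegree.

(** * Rank one matrices as cofactor matrices *)

(** Border a matrix [Y] of determinant [c] and unit diagonal by the row and column that put [a] in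
    the left and [b] in the right kernel. The kernels make all cofactors multiples of the one at (0,
    0), which is [\det Y]. *)
Lemma exists_singular_matrix (A : comNzRingType) (m : nat)
    (a b : 'I_m.+3 -> A) (c : A) : a 0 = 1 -> b 0 = 1 ->
  exists X : 'M[A]_m.+3, [/\ forall i, i != 0 -> X i i = 1, \det X = 0
    & forall i j, cofactor X i j = c * a i * b j].
Proof.
move=> a0 b0.
(* A 2x2 block of determinant 1 - (1 - c) = c whose diagonal entries are both 1. *)
pose B : 'M[A]_2 := \matrix_(i, j)
  (if (i == 0) && (j == 1) then 1 - c else 1).
have detB : \det B = c.
  rewrite (expand_det_row _ 0) !big_ord_recl big_ord0 /cofactor !det_mx11 !mxE /=.
  by rewrite expr0 expr1 !mul1r mulN1r addr0 mulrN1 opprB addrC subrK.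
pose Y : 'M[A]_(2 + m) := block_mx B 0 0 1%:M.
have detY : \det Y = c by rewrite det_ublock det1 mulr1.
have Y_diag i : Y i i = 1.
  rewrite -[i]splitK; case: (split i) => j /=.
    by rewrite block_mxEul mxE; case: eqP => // ->.
  by rewrite block_mxEdr mxE eqxx.
pose u : 'rV[A]_(m.+2) := \row_i a (lift 0 i).
pose v : 'cV[A]_(m.+2) := \col_i b (lift 0 i).
pose X : 'M[A]_(1 + m.+2) := block_mx (u *m Y *m v) (- (u *m Y)) (- (Y *m v)) Y.
have uX : row_mx 1%:M u *m X = 0.
  rewrite /X mul_row_block !mul1mx mulmxN mulmxA subrr.
  by rewrite [- _ + _]addrC subrr row_mx0.
have Xv : X *m col_mx 1%:M v = 0.
  rewrite /X mul_block_col !mulmx1 mulNmx subrr.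
  by rewrite [- _ + _]addrC subrr col_mx0.
have w0 : row_mx 1%:M u 0 0 = 1.
  by rewrite (_ : 0 = lshift m.+2 (0 : 'I_1)) ?row_mxEl ?mxE //; apply: val_inj.
have wE i : row_mx 1%:M u 0 i = a i.
  have [->|] := eqVneq i 0; first by rewrite w0 a0.
  rewrite eq_sym => /unlift_some[j -> _]; rewrite -rshift1.
  by rewrite row_mxEr mxE rshift1.
have vE i : col_mx 1%:M v i 0 = b i.
  have [->|] := eqVneq i 0.
    rewrite b0 (_ : 0 = lshift m.+2 (0 : 'I_1)) ?col_mxEu ?mxE //; exact: val_inj.
  rewrite eq_sym => /unlift_some[j -> _]; rewrite -rshift1.
  by rewrite col_mxEd mxE rshift1.
have cof00 : cofactor X 0 0 = c.
  rewrite /cofactor expr0 mul1r -detY; congr (\det _); apply/matrixP => i j.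
  by rewrite [LHS]mxE [LHS]mxE -!rshift1 block_mxEdr.
exists X; split=> [i||i j].
- by rewrite eq_sym => /unlift_some[j -> _]; rewrite -rshift1 [LHS]block_mxEdr.
- have := congr1 (fun M : 'rV_m.+3 => (M *m \adj X) 0 0) uX.
  by rewrite -mulmxA mul_mx_adj mul_mx_scalar mul0mx [LHS]mxE w0 mulr1 mxE.
have := cofactor_left_kernel i j 0 uX; rewrite !wE a0 mul1r => ->.
have := cofactor_right_kernel 0 j 0 Xv; rewrite !vE b0 mul1r cof00 => ->.
by rewrite mulrA mulrC mulrA.
Qed.

(** * Variables as matrix positions, and the gradient of the determinant *)

Section IndexPairs.

Variables (k : fieldType) (M : nat).
Local Notation m := M.+3.
Local Notation n := (m ^ 2).-1.
Local Notation p := (inord M.+1 : 'I_m).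
Local Notation q := (ord_max : 'I_m).
Implicit Types (i j : 'I_m) (t : 'I_n).

Definition row_of t : 'I_m := inord (t %/ m).
Definition col_of t : 'I_m := inord (t %% m).

Lemma nvarsE : n.+1 = (m * m)%N.
Proof. by rewrite prednK ?expn_gt0 // expnS expn1. Qed.

Lemma index_pairE t : (row_of t * m + col_of t)%N = t.
Proof.
rewrite /row_of /col_of !inordK ?ltn_mod -?divn_eq //.
by rewrite ltn_divLR // -nvarsE ltnS ltnW.
Qed.

Lemma index_pair_neq t : (row_of t == q) && (col_of t == q) = false.
Proof.
apply/negP => /andP[/eqP r /eqP c]; have := ltn_ord t.
rewrite -[X in (X < _)%N]index_pairE r c -ltnS nvarsE /=; lia.
Qed.

Lemma xvar_index t : xvar k m (row_of t) (col_of t) = 'X_t.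
Proof. by rewrite /xvar index_pairE valK. Qed.

Lemma index_of_pair i j : (i == q) && (j == q) = false ->
  exists t, row_of t = i /\ col_of t = j.
Proof.
move=> ne; suff lt : (i * m + j < n)%N.
  exists (Ordinal lt); rewrite /row_of /col_of /=.
  rewrite divnMDl // modnMDl divn_small // modn_small // addn0.
  by rewrite !inord_val.
rewrite -ltnS nvarsE -addSn; have := ltn_ord i; rewrite ltnS leq_eqVlt.
case/orP => [/eqP iM|lt_i]; last by have := ltn_ord j; nia.
have : j != q by move: ne; rewrite -val_eqE /= iM eqxx /= => ->.
rewrite -val_eqE /=; have := ltn_ord j; rewrite iM; lia.
Qed.

(* The indices p and q are m-1 and m in the paper. As the variable x_(p,p) also
   occurs at the position (q,q), its partial derivative collects both entries of
   the cofactor matrix. *)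
Definition collapse (A : nmodType) (C : 'I_m -> 'I_m -> A) : n.-tuple A :=
  [tuple C (row_of t) (col_of t) +
     (if (row_of t == p) && (col_of t == p) then C q q else 0) | t < n].

Lemma p_neq_q : (p == q) = false.
Proof. by rewrite -val_eqE /= inordK // eqn_leq ltnn andbF. Qed.

Lemma GCE i j : GC k m i j =
  if (i == q) && (j == q) then xvar k m p p else xvar k m i j.
Proof. by rewrite mxE /= inordK. Qed.

Lemma sum_delta (A : pzSemiRingType) (r s : 'I_m) (C : 'I_m -> 'I_m -> A) :
  \sum_i \sum_j ((i == r) && (j == s))%:R * C i j = C r s.
Proof.
rewrite (bigD1 r) //= (bigD1 s) //= !eqxx mul1r !big1 ?addr0 //.
  by move=> i /negbTE->; apply: big1 => j _; rewrite mul0r.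
by move=> j /negbTE->; rewrite mul0r.
Qed.

Lemma mderiv_xvar i j t : (i == q) && (j == q) = false ->
  (xvar k m i j)^`M(t) = ((i == row_of t) && (j == col_of t))%:R.
Proof.
move=> /index_of_pair[t' [<- <-]]; rewrite xvar_index mderivX mnm1E.
have -> : (row_of t' == row_of t) && (col_of t' == col_of t) = (t' == t).
  apply/andP/eqP => [[/eqP r /eqP c]|->] //.
  by apply: val_inj; rewrite /= -index_pairE r c index_pairE.
case: eqP => [->|_]; last by rewrite scale0r.
by rewrite scale1r -[X in (X - _)%MM]add0m addmK mpolyX0.
Qed.

Lemma gradient_det t :
  tnth (gradient (\det (GC k m))) t = tnth (collapse (cofactor (GC k m))) t.
Proof.
rewrite !tnth_mktuple mderiv_det.
pose pt := (row_of t == p) && (col_of t == p).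
(* The second indicator is the derivative of the entry (q, q), which is the variable at (p, p); the
   first one never fires there, as (q, q) carries no variable of its own. *)
transitivity (\sum_i \sum_j (((i == row_of t) && (j == col_of t))%:R *
    cofactor (GC k m) i j +
    ((i == q) && (j == q))%:R * (pt%:R * cofactor (GC k m) i j))).
  apply: eq_bigr => i _; apply: eq_bigr => j _.
  rewrite mulrA -mulrDl GCE; congr (_ * _).
  case: (boolP (_ && _)) => [/andP[/eqP-> /eqP->]|/negbTE ne].
    rewrite mderiv_xvar ?p_neq_q // mul1r [p == _]eq_sym [p == col_of t]eq_sym.
    by rewrite [q == _]eq_sym [q == col_of t]eq_sym index_pair_neq add0r.
  by rewrite mderiv_xvar // mul0r addr0.
under eq_bigr do rewrite big_split /=.
rewrite big_split /= !sum_delta /pt; congr (_ + _).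
by case: ifP; rewrite ?mul1r ?mul0r.
Qed.

(** [GC] is the generic matrix subject to this single equation, so every such [X] is a
    specialization of it. *)
Lemma GC_comp l (X : 'M[{mpoly k[l]}]_m) : X p p = X q q ->
  map_mx (comp_mpoly [tuple X (row_of t) (col_of t) | t < n]) (GC k m) = X.
Proof.
move=> Xpq; apply/matrixP => i j; rewrite mxE GCE.
have xvarX i' j' : (i' == q) && (j' == q) = false ->
    xvar k m i' j' \mPo [tuple X (row_of t) (col_of t) | t < n] = X i' j'.
  move=> /index_of_pair[t [<- <-]].
  by rewrite xvar_index comp_mpolyXU -tnth_nth tnth_mktuple.
case: (boolP (_ && _)) => [/andP[/eqP-> /eqP->]|/negbTE ne]; last exact: xvarX.
by rewrite xvarX ?p_neq_q.
Qed.

End IndexPairs.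

(** * Upper bound: comparison with the projected Segre variety *)

Section DualVarietyOfDeterminant.

Variables (k : fieldType) (M : nat).
Local Notation m := M.+3.
Local Notation n := (m ^ 2).-1.
Local Notation p := (inord M.+1 : 'I_m).
Local Notation q := (ord_max : 'I_m).
Local Notation f := (\det (GC k m)).
Implicit Types (i j : 'I_m) (t : 'I_n) (F : {mpoly k[n]}).

Lemma collapse_comp l l' (C : 'I_m -> 'I_m -> {mpoly k[l]})
    (h : l.-tuple {mpoly k[l']}) :
  [tuple tnth (collapse C) t \mPo h | t < n] = collapse (fun i j => C i j \mPo h).
Proof.
apply: eq_from_tnth => t; rewrite !tnth_mktuple comp_mpolyD.
by case: ifP; rewrite ?comp_mpoly0.
Qed.

Lemma collapse_homog l (mf : measure l) (C : 'I_m -> 'I_m -> {mpoly k[l]}) t :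
  (forall i j, C i j \is 1.-homog for mf) -> tnth (collapse C) t \is 1.-homog for mf.
Proof.
by move=> homC; rewrite tnth_mktuple; case: ifP => _; rewrite rpredD // rpred0.
Qed.

Lemma collapse_pivot l (C : 'I_m -> 'I_m -> {mpoly k[l]}) t :
  (row_of t == p) && (col_of t == p) = false ->
  tnth (collapse C) t = C (row_of t) (col_of t).
Proof. by move=> ne; rewrite tnth_mktuple ne addr0. Qed.

Definition segre : n.-tuple {mpoly k[m + m]} :=
  collapse (fun i j => 'X_(lshift m i) * 'X_(rshift m j)).

(* Modulo g the matrix C has rank one, so that C i j * C r c agrees with the
   product of column j and row i of C, which is a value of the Segre map. *)
Lemma rank_one_vanishing (C : 'I_m -> 'I_m -> {mpoly k[n]}) (g : {mpoly k[n]}) d F i j :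
  (forall r c, exists Q, C i j * C r c - C r j * C i c = Q * g) ->
  F \is d.-homog -> F \mPo segre = 0 ->
  exists Q, C i j ^+ d * (F \mPo collapse C) = Q * g.
Proof.
move=> minor homF F0; rewrite -(comp_mpoly_scale _ _ homF).
have [|Q] := comp_mpoly_congr F
    (g := [tuple C i j * tnth (collapse C) t | t < n])
    (h := collapse (fun r c => C r j * C i c)) (f := g).
  move=> t; rewrite !tnth_mktuple.
  have [Q1 E1] := minor (row_of t) (col_of t); have [Q2 E2] := minor q q.
  case: ifP => _; last by exists Q1; rewrite !addr0.
  by exists (Q1 + Q2); rewrite mulrDr mulrDl -E1 -E2 opprD addrACA.
pose h : (m + m).-tuple {mpoly k[n]} :=
  [tuple match split x with inl r => C r j | inr c => C i c end | x < m + m].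
have -> : F \mPo collapse (fun r c => C r j * C i c) = 0.
  rewrite -(comp_mpoly0 h) -F0 comp_mpoly_assoc collapse_comp.
  congr (F \mPo _); apply: eq_from_tnth => t; rewrite !tnth_mktuple.
  have hl r : 'X_(lshift m r) \mPo h = C r j.
    by rewrite comp_mpolyXU -tnth_nth tnth_mktuple (unsplitK (inl _ r)).
  have hr c : 'X_(rshift m c) \mPo h = C i c.
    by rewrite comp_mpolyXU -tnth_nth tnth_mktuple (unsplitK (inr _ c)).
  by rewrite !rmorphM /= !hl !hr.
by rewrite subr0 => ->; exists Q.
Qed.

(** Away from (p, p) a partial derivative is a single cofactor, so ['X_t ^+ d] supplies the power of
    the pivot in [rank_one_vanishing]. *)
Lemma dual_ideal_pivot d F t : (row_of t == p) && (col_of t == p) = false ->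
  F \is d.-homog -> F \mPo segre = 0 -> dual_ideal f ('X_t ^+ d * F).
Proof.
move=> ne homF F0.
have minor := cofactor_minor (GC k m) (row_of t) (col_of t).
have [Q EQ] := rank_one_vanishing minor homF F0.
exists Q; rewrite -EQ rmorphM rmorphXn /= comp_mpolyXU -tnth_nth.
have -> : gradient f = collapse (cofactor (GC k m)).
  by apply: eq_from_tnth => t'; rewrite gradient_det.
by rewrite collapse_pivot.
Qed.

Lemma row_col_inj t t' : row_of t = row_of t' -> col_of t = col_of t' -> t = t'.
Proof.
by move=> r c; apply: val_inj; rewrite /= -index_pairE r c index_pairE.
Qed.

(* If P contains all variables except possibly 'X_t, where t is the position
   (p, p), then modulo P the form F is its value at the coordinate point t times
   'X_t ^+ d, and this coordinate point is the Segre image of (e_p, e_p). *)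
Lemma segre_ker_sub P d F : proj_point P ->
  (forall G, dual_ideal f G -> G \in P) ->
  F \is d.-homog -> F \mPo segre = 0 -> F \in P.
Proof.
move=> PP JP homF F0; pose off t := ~~ ((row_of t == p) && (col_of t == p)).
(* If a variable away from (p, p) lies outside [P], primality removes its power from
   [dual_ideal_pivot]. *)
have [/existsP[t /andP[/negbTE tne Xt]]|] := boolP [exists t, off t && ('X_t \notin P)].
  apply: (proj_point_prime PP (JP _ (dual_ideal_pivot tne homF F0))).
  by apply: contra Xt; apply: proj_pointX.
rewrite negb_exists => /forallP noP.
have XP t : off t -> 'X_t \in P.
  by move=> ot; have := noP t; rewrite ot negbK.
have pq : (p == q) && (p == q) = false by rewrite p_neq_q.
have [t0 [r0 c0]] := index_of_pair pq.
have onE t : (row_of t == p) && (col_of t == p) = (t == t0).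
  apply/andP/eqP => [[/eqP r /eqP c]|->]; last by rewrite r0 c0.
  by apply: row_col_inj; rewrite ?r ?c.
pose nu x : k := match split x with inl i => (i == p)%:R | inr j => (j == p)%:R end.
have ev0 : F.@[fun t => (t == t0)%:R] = 0.
  transitivity ((F \mPo segre).@[nu]); last by rewrite F0 meval0.
  rewrite comp_mpoly_meval; apply: meval_eq => t; rewrite tnth_mktuple mevalD.
  have ev i j : ('X_(lshift m i) * 'X_(rshift m j)).@[nu] = ((i == p) && (j == p))%:R.
    rewrite mevalM !mevalXU /nu (unsplitK (inl _ i)) (unsplitK (inr _ j)).
    by rewrite -natrM mulnb.
  rewrite ev onE; case: ifP => _.
    by rewrite ev [q == _]eq_sym p_neq_q addr0.
  by rewrite meval0 addr0.
suff : F - F.@[fun t => (t == t0)%:R] *: 'X_t0 ^+ d \in P by rewrite ev0 scale0r subr0.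
rewrite mevalE {1}[F]mpolyE scaler_suml -sumrB big_seq.
apply: (proj_point_sum PP) => s /(dhomog_mf homF) sd.
(* A monomial involving another variable lies in [P] and vanishes at the coordinate point; the only
   other one is ['X_t0 ^+ d], whose two contributions cancel. *)
have [s0|] := boolP [exists t, (t != t0) && (s t != 0%N)].
  have [t /andP[tt0 st]] := existsP s0.
  rewrite (bigD1 t) //= (negbTE tt0) expr0n (negbTE st) mul0r mulr0 scale0r subr0.
  apply: (proj_pointZ PP); rewrite mpolyXE_id (bigD1 t) //=.
  rewrite mulrC; apply: (proj_pointMl PP).
  case: (s t) st => // e _; rewrite exprSr; apply: (proj_pointMl PP).
  by apply: XP; rewrite /off onE.
rewrite negb_exists => /forallP s0.
have st t : t != t0 -> s t = 0%N.
  by move=> tt0; have := s0 t; rewrite tt0 negbK => /eqP.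
have sE : s = (U_(t0) *+ d)%MM.
  apply/mnmP => t; rewrite mulmnE mnm1E -(sd : mdeg s = d) mdegE.
  rewrite (bigD1 t0) //= big1 // addn0.
  by case: eqVneq => [->|]; rewrite ?mul1n // mul0n eq_sym => /st.
rewrite big1 ?mulr1 => [|t _].
  by rewrite sE mpolyXn subrr proj_point0.
by case: eqVneq => [_|/st->]; rewrite ?expr1n ?expr0.
Qed.

Definition left_vars : pred 'I_(m + m) :=
  fun x => if split x is inl _ then true else false.

Lemma partial_deg_left (s : 'X_{1..m + m}) :
  partial_deg left_vars s = (\sum_i s (lshift m i))%N.
Proof.
rewrite /partial_deg big_split_ord /= addnC big1 => [|i].
  by rewrite add0n; apply: eq_bigl => i; rewrite /left_vars (unsplitK (inl _ i)).
by rewrite /left_vars (unsplitK (inr _ i)).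
Qed.

Lemma partial_deg_right (s : 'X_{1..m + m}) :
  partial_deg (predC left_vars) s = (\sum_j s (rshift m j))%N.
Proof.
rewrite /partial_deg big_split_ord /= big1 => [|i].
  by rewrite add0n; apply: eq_bigl => i; rewrite /= /left_vars (unsplitK (inr _ i)).
by rewrite /= /left_vars (unsplitK (inl _ i)).
Qed.

(** Each coordinate of [segre] is linear in the left variables and in the right ones, so
    substitution yields bidegree (d, d). *)
Lemma segre_support d F s : F \is d.-homog -> (F \mPo segre)@_s != 0 ->
  (\sum_i s (lshift m i))%N = d /\ (\sum_j s (rshift m j))%N = d.
Proof.
move=> homF nz; have deg (A : pred 'I_(m + m)) :
    (forall i j, A (lshift m i) + A (rshift m j) = 1)%N -> partial_deg A s = d.
  move=> A1; have /dhomog_nemf_coeff hom : F \mPo segre \is d.-homog for (partial_deg A).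
    apply: dhomog_comp_mpoly homF => t; apply: collapse_homog => i j.
    by rewrite -(A1 i j); apply: dhomogM; apply: dhomog_var.
  by apply/eqP; apply: contraNT nz => /hom->.
rewrite -partial_deg_left -partial_deg_right; split; apply: deg => i j;
by rewrite /= /left_vars (unsplitK (inl _ i)) (unsplitK (inr _ j)).
Qed.

(* A monomial of bidegree (d, d) is determined by its exponents at the
   variables other than 'X_(lshift m ord0) and 'X_(rshift m ord0). *)
Definition bidegree_monomial d
    (ab : {ffun 'I_m.-1 -> 'I_d.+1} * {ffun 'I_m.-1 -> 'I_d.+1}) : 'X_{1..m + m} :=
  let entry (a : {ffun 'I_m.-1 -> 'I_d.+1}) (i : 'I_m) : nat :=
    if unlift ord0 i is Some i' then a i' else (d - \sum_i' a i')%N in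
  [multinom match split x with
            | inl i => entry ab.1 i | inr j => entry ab.2 j end | x < m + m].

Lemma bidegree_monomial_surj d (s : 'X_{1..m + m}) :
  (\sum_i s (lshift m i))%N = d -> (\sum_j s (rshift m j))%N = d ->
  exists ab, s = @bidegree_monomial d ab.
Proof.
have entryE (e : 'I_m -> nat) : (\sum_i e i)%N = d ->
    exists a : {ffun 'I_m.-1 -> 'I_d.+1},
    forall i, e i = if unlift ord0 i is Some i' then a i' : nat else (d - \sum_i' a i')%N.
  rewrite big_ord_recl => ed.
  (* Every exponent is at most the total d, so [inord] does not alter it. *)
  pose a : {ffun 'I_m.-1 -> 'I_d.+1} := [ffun i : 'I_m.-1 => inord (e (lift ord0 i))].
  have aE (i : 'I_m.-1) : a i = e (lift ord0 i) :> nat.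
    by rewrite ffunE inordK // ltnS -ed (bigD1 i) //= addnCA leq_addr.
  exists a => i; case: unliftP => [i' ->|->]; first by rewrite aE.
  by rewrite (eq_bigr _ (fun x _ => aE x)) -ed addnK.
move=> /entryE[a aE] /entryE[b bE]; exists (a, b); apply/mnmP => x; rewrite mnmE.
by rewrite -[x in LHS]splitK; case: (split x) => i /=; rewrite ?aE ?bE.
Qed.

(** A form of degree d whose image under [segre] has no coefficient at the monomials of bidegree (d,
    d) is in the kernel, hence in [P]; the pairs encoding these monomials are then counted. *)
Lemma hilbert_ge_dual P d N : proj_point P ->
  (forall G, dual_ideal f G -> G \in P) ->
  hilbert_ge P d N -> (N <= d.+1 ^ (m.-1 + m.-1))%N.
Proof.
move=> PP JP hN.
have -> : (d.+1 ^ (m.-1 + m.-1) =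
    #|{: {ffun 'I_m.-1 -> 'I_d.+1} * {ffun 'I_m.-1 -> 'I_d.+1}}|)%N.
  by rewrite card_prod !card_ffun !card_ord expnD.
apply: (hilbert_ge_bound (g := segre) (mu := @bidegree_monomial d) _ hN).
move=> F homF F0; apply: (segre_ker_sub PP JP homF); apply/mpolyP => s.
rewrite mcoeff0; apply/eqP/negPn/negP => nz.
have [sl sr] := segre_support homF nz.
by have [ab sE] := bidegree_monomial_surj sl sr; rewrite sE F0 eqxx in nz.
Qed.

(** * Lower bound: a chain of cones in the dual variety *)

Local Notation r := (m.-1 + m.-1)%N.

(* The affine cone over the Segre variety, parametrized by c a_i b_j with
   a_0 = b_0 = 1; the variables of number > s are set to 0 except for c. *)
Definition cone_left (s i : nat) : {mpoly k[r.+1]} :=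
  if i == 0%N then 1 else if (i <= s)%N then 'X_(inord i) else 0.

Definition cone_right (s j : nat) : {mpoly k[r.+1]} :=
  if j == 0%N then 1 else if (m.-1 + j <= s)%N then 'X_(inord (m.-1 + j)) else 0.

Definition cone s : n.-tuple {mpoly k[r.+1]} :=
  collapse (fun i j => 'X_ord0 * cone_left s i * cone_right s j).

Definition kill s : r.+1.-tuple {mpoly k[r.+1]} :=
  [tuple if (x <= s)%N then 'X_x else 0 | x < r.+1].

Lemma kill_var s x : 'X_x \mPo kill s = if (x <= s)%N then 'X_x else 0.
Proof. by rewrite comp_mpolyXU -tnth_nth tnth_mktuple. Qed.

(** Each smaller cone is a specialization of a larger one, so the kernels grow as [s] decreases. *)
Lemma cone_kill F s s' : (s' <= s)%N -> (F \mPo cone s) \mPo kill s' = F \mPo cone s'.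
Proof.
move=> le_s's; rewrite comp_mpoly_assoc collapse_comp.
congr (F \mPo _); apply: eq_from_tnth => t; rewrite !tnth_mktuple.
have kl i : cone_left s (i : 'I_m) \mPo kill s' = cone_left s' i.
  rewrite /cone_left; case: ifP => _; first by rewrite comp_mpoly1.
  have ir : (i < r.+1)%N by have := ltn_ord i; lia.
  case: (leqP i s) => [_|lt]; first by rewrite kill_var inordK.
  by rewrite leqNgt (leq_ltn_trans le_s's lt) comp_mpoly0.
have kr j : cone_right s (j : 'I_m) \mPo kill s' = cone_right s' j.
  rewrite /cone_right; case: ifP => _; first by rewrite comp_mpoly1.
  have jr : (m.-1 + j < r.+1)%N by have := ltn_ord j; lia.
  case: (leqP _ s) => [_|lt]; first by rewrite kill_var inordK.
  by rewrite leqNgt (leq_ltn_trans le_s's lt) comp_mpoly0.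
have k0 : 'X_ord0 \mPo kill s' = 'X_ord0 by rewrite kill_var.
by rewrite !rmorphM /= !kl !kr !k0 (kl q) (kr q).
Qed.

(** Since [a] and [b] are normalized to start with 1, the cone is homogeneous only with respect to
    the scaling variable c, which is number 0. *)
Definition first_var : pred 'I_r.+1 := pred1 ord0.

Lemma dhomog_first_var x : (0 < x < r.+1)%N ->
  ('X_(inord x) : {mpoly k[r.+1]}) \is 0.-homog for (partial_deg first_var).
Proof.
case/andP=> x0 xr; have := dhomog_var k first_var (inord x).
by rewrite /first_var /= -val_eqE /= inordK // eqn0Ngt x0.
Qed.

Lemma cone_homog s t : tnth (cone s) t \is 1.-homog for (partial_deg first_var).
Proof.
apply: collapse_homog => i j; rewrite -[1%N]addn0; apply: dhomogM.
  rewrite -[1%N]addn0; apply: dhomogM; first exact: dhomog_var.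
  rewrite /cone_left; case: posnP => [_|i0]; first exact: dhomog1.
  case: ifP => _; last exact: dhomog0.
  by apply: dhomog_first_var; have := ltn_ord i; lia.
rewrite /cone_right; case: posnP => [_|j0]; first exact: dhomog1.
case: ifP => _; last exact: dhomog0.
by apply: dhomog_first_var; have := ltn_ord j; lia.
Qed.

(** The first row and column avoid (p, p) and (q, q), because p > 0 for matrices of size at least 3;
    these coordinates are unaffected by the projection. *)
Lemma cone_axis i j : (i == ord0) || (j == ord0) -> exists t, forall s,
  tnth (cone s) t = 'X_ord0 * cone_left s i * cone_right s j.
Proof.
move=> ij0; have nqq : (i == q) && (j == q) = false.
  by apply/negP => /andP[/eqP iq /eqP jq]; rewrite iq jq in ij0.
have p0 : (p == ord0) = false by rewrite -val_eqE /= inordK.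
have npp : (i == p) && (j == p) = false.
  by apply/negP => /andP[/eqP ip /eqP jp]; rewrite ip jp p0 in ij0.
have [t [ti tj]] := index_of_pair nqq; exists t => s.
by rewrite collapse_pivot ti tj.
Qed.

Lemma mpolyX_neq0 l (x : 'I_l) : ('X_x : {mpoly k[l]}) != 0.
Proof. by rewrite -msupp_eq0 msuppX. Qed.

Lemma cone_point s : proj_point [pred F | F \mPo cone s == 0].
Proof.
apply: (proj_point_ker (cone_homog s)).
have [t tE] := @cone_axis ord0 ord0 isT; exists t.
by rewrite tE !mulr1 mpolyX_neq0.
Qed.

(** The newly freed variable of number s+1 is an entry of [a] or of [b]; the coordinate in the first
    column, respectively the first row, where it is multiplied only by c, detects it. *)
Lemma cone_strict s : (s < r)%N ->
  exists t, tnth (cone s) t = 0 /\ tnth (cone s.+1) t != 0.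
Proof.
move=> lt_sr; have nz := mpolyX_neq0.
have [le_sm|lt_ms] := leqP s.+1 m.-1.
  have sm : (s.+1 < m)%N by lia.
  have [t tE] := @cone_axis (Ordinal sm) ord0 isT; exists t.
  rewrite !tE /cone_left /cone_right /= leqnn ltnn mulr0 mul0r.
  by rewrite mulr1 mulf_neq0 ?nz.
have sm : (s.+1 - m.-1 < m)%N by lia.
have [t tE] := @cone_axis ord0 (Ordinal sm) isT; exists t.
have sE : (m.-1 + (s.+1 - m.-1) = s.+1)%N by rewrite subnKC // ltnW.
have s0 : (s.+1 - m.-1 == 0)%N = false by apply/negbTE; rewrite -lt0n subn_gt0.
have jE : nat_of_ord (Ordinal sm) = (s.+1 - m.-1)%N by [].
rewrite !tE /cone_left eqxx /cone_right jE s0 sE leqnn ltnn mulr0 mulr1.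
by rewrite mulf_neq0 ?nz.
Qed.

(** Substitute the matrix of [exists_singular_matrix] into the equation defining [dual_ideal]: [f]
    becomes 0 and the gradient becomes the cone. *)
Lemma dual_ideal_cone F : dual_ideal f F -> F \mPo cone r = 0.
Proof.
case=> G FG; pose c : {mpoly k[r.+1]} := 'X_ord0.
have [X [Xdiag detX cofX]] := @exists_singular_matrix _ M
  (fun i => cone_left r i) (fun j => cone_right r j) c erefl erefl.
have Xpq : X p p = X q q by rewrite !Xdiag // -val_eqE /= inordK.
have GCX := GC_comp Xpq.
pose h := [tuple X (row_of t) (col_of t) | t < n].
have := congr1 (comp_mpoly h) FG; rewrite rmorphM /=.
rewrite -det_map_mx GCX detX mulr0 comp_mpoly_assoc => <-.
congr (F \mPo _); apply: eq_from_tnth => t; rewrite [RHS]tnth_mktuple gradient_det.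
transitivity (tnth [tuple tnth (collapse (cofactor (GC k m))) t \mPo h | t < n] t).
  rewrite collapse_comp; congr (tnth _ _); apply: eq_from_tnth => t'.
  by rewrite !tnth_mktuple -!cofactor_map_mx GCX !cofX.
by rewrite tnth_mktuple.
Qed.

Lemma dual_dim_det : dual_dim f r.
Proof.
split=> [|e P [PP JP strict]].
  (* The index is reversed, since the primes must increase while the cones shrink. *)
  exists (fun s => [pred F | F \mPo cone (r - s) == 0] : {pred {mpoly k[n]}}).
  split=> [s _|s _ F JF|s lt_sr].
  - exact: cone_point.
  - by rewrite inE -(cone_kill F (leq_subr s r)) dual_ideal_cone // comp_mpoly0.
  have sE : (r - s = (r - s.+1).+1)%N by rewrite subnSK.
  have lt_ur : (r - s.+1 < r)%N by lia.
  rewrite sE; move: (r - s.+1)%N lt_ur => u lt_ur; split=> [F /eqP F0|sub].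
    by apply/eqP; rewrite -(cone_kill F (leqnSn u)) F0 comp_mpoly0.
  have [t [t0 t1]] := cone_strict lt_ur.
  have := sub 'X_t; rewrite !inE !comp_mpolyXU -!tnth_nth t0 eqxx.
  by move/(_ isT); apply/negP.
have [c _ Hc] := hilbert_ge_chain PP strict.
apply: (@exponent_leq_of_bound c) => d.
exact: (hilbert_ge_dual (PP 0%N isT) (JP 0%N isT) (Hc d)).
Qed.

End DualVarietyOfDeterminant.

Theorem theorem2p5 (k : fieldType) (m : nat)
    (char0 : [pchar k] =i pred0) (m_ge3 : (3 <= m)%N) :
  let f := \det (GC k m) in
  dual_dim f (2 * m - 2)%N /\
  expected_hessian_mult f (m%:Z * (m%:Z - 2) - 1).
Proof.
case: m m_ge3 => [|[|[|M]]] // _ f.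
have dimE : (2 * M.+3 - 2 = M.+3.-1 + M.+3.-1)%N by lia.
have dim : dual_dim f (2 * M.+3 - 2) by rewrite dimE; apply: dual_dim_det.
split=> //; exists (2 * M.+3 - 2)%N => //.
(* The ambient projective space has dimension m^2 - 2, and m^2 - 2 - (2m - 2) - 1 = m(m - 2) - 1. *)
have := nvarsE M; lia.
Qed.
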